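(* Let $n$ be a positive integer with $n \notin \{12, 234\}$ and $I(n) = I(12) = I(234) = \frac{7}{3}$. (i) If $n$ is odd, then there exist an integer $k \geq 4$, distinct primes $p_1, \dots, p_k$, all greater than $3$, and positive integers $a, e_1, \dots, e_k$ such that $$n = 3^{2a} \prod_{i=1}^{k} p_i^{2e_i}.$$ (ii) If $n$ is even, then there exist an integer $k \geq 2$, distinct primes $q, p_1, \dots, p_k$, all greater than or equal to $29$, and positive integers $a, e, e_1, \dots, e_k$ with $a \geq 3$ and $q \equiv e \equiv 1 \pmod 4$ such that $$n = 2 \cdot 3^{2a} \cdot q^{e} \prod_{i=1}^{k} p_i^{2e_i}.$$
   Context: For a positive integer $n$, $\sigma(n)$ denotes the sum of all positive divisors of $n$ (including $n$ itself), and the abundancy index of $n$ is the rational number $I(n) = \frac{\sigma(n)}{n}$. *)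

(* Defs.v *)
From mathcomp Require Import all_boot all_order all_algebra.

Set Implicit Arguments.
Unset Strict Implicit.
Unset Printing Implicit Defensive.

Import GRing.Theory.

Definition sigma (n : nat) : nat := \sum_(d <- divisors n) d.

Definition abundancy (n : nat) : rat := ((sigma n)%:R / n%:R)%R.

(* 12 and 234 share the abundancy index 7/3: the hypothesis I(n) = I(12) = I(234)
   amounts to I(n) = 7/3. *)
Lemma abundancy_12 : abundancy 12 = (7 / 3)%R.
Proof.
rewrite /abundancy (_ : sigma 12 = 28) //.
by rewrite /sigma (_ : divisors 12 = [:: 1; 2; 3; 4; 6; 12]) // unlock.
Qed.

Lemma abundancy_234 : abundancy 234 = (7 / 3)%R.
Proof.
rewrite /abundancy (_ : sigma 234 = 546).
  by apply/eqP; rewrite eqr_div ?pnatr_eq0 // -!natrM eqr_nat.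
rewrite /sigma (_ : divisors 234 =
  [:: 1; 2; 3; 6; 9; 13; 18; 26; 39; 78; 117; 234]) //.
by rewrite !big_cons big_nil.
Qed.

(* Main.v *)
From Stdlib Require Import NArith.
Require Import Defs.
From mathcomp Require Import all_boot all_order all_algebra.
From mathcomp Require Import zify.

Set Implicit Arguments.
Unset Strict Implicit.
Unset Printing Implicit Defensive.

(** Write sigma n for the divisor sum and I(n) = sigma n / n, so that the
    hypothesis reads 3 sigma n = 7 n. Two bounds on abundancy indices are used
    throughout: a proper divisor of n has a smaller index
    ([sigma_dvdn_ltn]), and I(n) is at most the product of p / (p - 1) over the
    primes p dividing n ([sigma_upper_bound]). Since sigma is multiplicative,
    sigma (p ^ v) divides 7 n whenever p ^ v is the exact power of p in n, so
    that prime factors of sigma (p ^ v) other than 7 also divide n. Finally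
    sigma (p ^ v) is odd exactly when v is even, for p odd.

    If n is odd then 3 divides n and sigma n is odd, so that all exponents are
    even. The upper bound leaves only the supports {3, 5, 7, 11} and
    {3, 5, 7, 13} with at most four primes. There the exponent of 3 is at least
    4, again by the upper bound, and that of 5 is at least 4 because
    sigma 25 = 31; but then the divisor 3^4 * 5^4 * 7^2 * r^2 is too abundant
    ([odd_case4_false]).

    If n is even then 3 divides n, and 4 does not since I(12) = 7/3; hence
    n = 2 m with m odd and 9 sigma m = 14 m. As sigma m is twice an odd number,
    exactly one prime q has an odd exponent e in m, and q = e = 1 modulo 4. The
    exponent of 3 is positive and even; it is not 2, since sigma 9 = 13 and
    I(234) = 7/3, and it is not 4, since sigma 81 = 11^2 and 3^4 * 11^2 is too
    abundant. So 3^6 divides m, and 3^6 * p is too abundant for the primes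
    3 < p < 29. The upper bound excludes that q is the only prime besides 3.

    The remaining case is m = 3^v * p^f * q^e with p, q >= 29. The upper bound
    becomes (p - 28)(q - 28) <= 756, so that the smaller prime is at most 47 and
    the larger one at most 784 ([two_primes_bound]). The number
    sigma (3^v) = (3^(v+1) - 1) / 2 has no prime factor but p and q, and v + 1
    is odd. Modulo one of the two primes, 3 has even order, so this prime does
    not divide 3^(v+1) - 1 ([prime_ndvd_pow3_odd]). Hence sigma (3^v) is a power
    of the other prime t. With g = gcd (t - 1, v + 1), (3^g - 1) / 2 is a
    positive power of t too, and it divides 3^((t-1)/2) - 1. A computation
    shows that t^2 does not divide the latter for 29 <= t <= 784, so that
    t = (3^g - 1) / 2 with g odd; but no prime of this form lies in that range
    ([repunit3_neq_pfactor]). *)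

(** * The divisor sum *)

Lemma dvdn_coprime_mul d a b :
  coprime a b -> d %| a * b -> d = gcdn d a * gcdn d b.
Proof.
move=> co_ab d_ab; apply/eqP; rewrite eqn_dvd Gauss_dvd ?dvdn_gcdl ?andbT.
  rewrite muln_gcdl !muln_gcdr !dvdn_gcd d_ab.
  by rewrite !(dvdn_mulr _ (dvdnn d)) (dvdn_mull _ (dvdnn d)).
exact: coprime_dvdl (dvdn_gcdr d a) (coprime_dvdr (dvdn_gcdr d b) _).
Qed.

Lemma sigma_coprime a b : coprime a b -> sigma (a * b) = sigma a * sigma b.
Proof.
have sigma1 : sigma 1 = 1 by rewrite /sigma big_seq1.
have [-> | a_gt0] := posnP a.
  by rewrite /coprime gcd0n => /eqP ->; rewrite sigma1 !muln1.
have [-> | b_gt0] := posnP b.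
  by rewrite /coprime gcdn0 => /eqP ->; rewrite sigma1 !mul1n.
move=> co_ab.
have gcdK (x y : nat) : x %| a -> y %| b -> gcdn (x * y) a = x.
  move=> /dvdnP[x' def_a] yb.
  have co_ya : coprime y a.
    by rewrite coprime_sym; apply: coprime_dvdr yb co_ab.
  rewrite gcdnC Gauss_gcdl 1?coprime_sym // gcdnC.
  by apply/gcdn_idPl; apply/dvdnP; exists x'.
have divE : perm_eq (divisors (a * b))
                    [seq x * y | x <- divisors a, y <- divisors b].
  apply: uniq_perm; first exact: divisors_uniq.
    apply: allpairs_uniq; [exact: divisors_uniq | exact: divisors_uniq |].
    move=> [x y] [x' y'] /allpairsP[[u v] /= [ua vb [-> ->]]].
    move=> /allpairsP[[u' v'] /= [u'a v'b [-> ->]]] eq_uv.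
    move: ua vb u'a v'b; rewrite -!dvdn_divisors // => ua vb u'a v'b.
    have eq_u : u = u' by rewrite -(gcdK u v) // eq_uv gcdK.
    have u_gt0 := dvdn_gt0 a_gt0 ua.
    by move/eqP: eq_uv; rewrite -eq_u eqn_pmul2l // => /eqP ->.
  move=> d; rewrite -dvdn_divisors ?muln_gt0 ?a_gt0 //.
  apply/idP/allpairsP => [d_ab | [[x y] /= [xa yb ->]]].
    exists (gcdn d a, gcdn d b); rewrite -!dvdn_divisors //=.
    split; rewrite ?dvdn_gcdr //.
    exact: dvdn_coprime_mul.
  by move: xa yb; rewrite -!dvdn_divisors //; exact: dvdn_mul.
rewrite /sigma (perm_big _ divE) big_allpairs_dep big_distrl /=.
by apply: eq_bigr => x _; rewrite big_distrr.
Qed.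

Lemma sigma_pfactor p e : prime p -> sigma (p ^ e) = \sum_(i < e.+1) p ^ i.
Proof.
move=> p_pr; have p_gt1 := prime_gt1 p_pr; have p_gt0 := prime_gt0 p_pr.
have pe_gt0 : 0 < p ^ e by rewrite expn_gt0 p_gt0.
have divE : perm_eq (divisors (p ^ e)) [seq p ^ i | i <- iota 0 e.+1].
  apply: uniq_perm; first exact: divisors_uniq.
    by rewrite map_inj_uniq ?iota_uniq //; apply: expnI.
  move=> d; rewrite -dvdn_divisors //; apply/(dvdn_pfactor _ _ p_pr)/mapP.
    by case=> m le_me ->; exists m; rewrite // mem_iota.
  by case=> m; rewrite mem_iota /= => lt_me ->; exists m.
rewrite /sigma (perm_big _ divE) big_map.
by rewrite -(big_mkord xpredT) /index_iota subn0.
Qed.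

(** Every divisor [d] of [n] contributes [n / d] times itself to [sigma n]: a
    proper divisor of [n] has a smaller abundancy index. *)
Lemma sigma_dvdn_ltn d n :
  0 < n -> d %| n -> d <> n -> sigma d * n < sigma n * d.
Proof.
move=> n_gt0 /dvdnP[c def_n] neq_dn.
have d_gt0 : 0 < d by case: d def_n n_gt0 {neq_dn} => // ->; rewrite muln0.
have c_gt1 : 1 < c.
  case: c def_n => [|[|c]] // def_n; first by rewrite def_n in n_gt0.
  by case: neq_dn; rewrite def_n mul1n.
have c_gt0 := ltnW c_gt1.
rewrite def_n mulnA ltn_pmul2r // -def_n {1}/sigma big_distrl /= -add1n.
have -> : 1 + \sum_(i <- divisors d) i * c
          = \sum_(x <- 1 :: [seq i * c | i <- divisors d]) x.
  by rewrite big_cons big_map.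
apply: (uniq_sub_le_big leqnn (fun x y => leq_addr y x)).
- rewrite /= map_inj_uniq ?divisors_uniq ?andbT; last first.
    by move=> x y /eqP; rewrite eqn_pmul2r // => /eqP.
  apply/negP => /mapP[x _ /esym/eqP]; rewrite muln_eq1 => /andP[_ /eqP c1].
  by rewrite c1 in c_gt1.
- exact: divisors_uniq.
- move=> x; rewrite inE -dvdn_divisors // => /orP[/eqP -> // |].
  case/mapP => y; rewrite -dvdn_divisors // => yd ->.
  by rewrite def_n mulnC dvdn_pmul2l.
Qed.

Lemma prod_primes n : 0 < n -> n = \prod_(p <- primes n) p ^ logn p n.
Proof.
by move=> n_gt0; rewrite {1}(prod_prime_decomp n_gt0) prime_decompE big_map.
Qed.

Lemma sigma_prod_primes (s : seq nat) (e : nat -> nat) :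
  uniq s -> all prime s ->
  sigma (\prod_(p <- s) p ^ e p) = \prod_(p <- s) sigma (p ^ e p).
Proof.
elim: s => [|p s IHs] /=; first by rewrite !big_nil /sigma big_seq1.
case/andP=> p_s s_uniq /andP[p_pr s_pr].
rewrite !big_cons sigma_coprime ?IHs //.
rewrite big_seq; apply: (big_ind (fun x => coprime (p ^ e p) x)).
- exact: coprimen1.
- by move=> x y px py; rewrite coprimeMr px.
move=> r r_s; have r_pr : prime r := allP s_pr r r_s.
apply: coprimeXl; apply: coprimeXr.
rewrite prime_coprime // dvdn_prime2 //.
by apply: contraNneq p_s => ->.
Qed.

Lemma all_prime_primes n : all prime (primes n).
Proof. by apply/allP => p; rewrite mem_primes => /and3P[]. Qed.

Lemma sigma_primes n :
  0 < n -> sigma n = \prod_(p <- primes n) sigma (p ^ logn p n).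
Proof.
move=> n_gt0; rewrite {1}(prod_primes n_gt0).
by rewrite sigma_prod_primes ?primes_uniq ?all_prime_primes.
Qed.

(** The abundancy index of [n] is at most the product of [p / (p - 1)] over
    the primes [p] dividing [n]. *)
Lemma sigma_upper_bound n :
  0 < n ->
  sigma n * \prod_(p <- primes n) p.-1 <= n * \prod_(p <- primes n) p.
Proof.
move=> n_gt0; rewrite [X in _ <= X * _](prod_primes n_gt0) sigma_primes //.
rewrite -!big_split /=.
rewrite big_seq [X in _ <= X]big_seq; apply: leq_prod => p.
rewrite mem_primes => /andP[p_pr _].
by rewrite sigma_pfactor // mulnC -predn_exp expnSr leq_pred.
Qed.

Lemma sigma_split_pfactor p n : prime p -> 0 < n ->
  exists m, [/\ 0 < m, coprime p m, n = p ^ logn p n * m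
               & sigma n = sigma (p ^ logn p n) * sigma m].
Proof.
move=> p_pr n_gt0; have [m co_pm def_n] := pfactor_coprime p_pr n_gt0.
exists m; split=> //.
  by rewrite lt0n; apply: contraTneq n_gt0 => m0; rewrite def_n m0.
  by rewrite mulnC.
by rewrite {1}def_n mulnC sigma_coprime ?coprimeXl.
Qed.

Lemma sigma_pfactor_dvdn p n :
  prime p -> 0 < n -> sigma (p ^ logn p n) %| sigma n.
Proof.
move=> p_pr n_gt0; have [m [_ _ _ ->]] := sigma_split_pfactor p_pr n_gt0.
exact: dvdn_mulr.
Qed.

Lemma odd_sigma_pfactor p e :
  prime p -> odd p -> odd (sigma (p ^ e)) = ~~ odd e.
Proof.
move=> p_pr p_odd; rewrite sigma_pfactor //.
elim: e => [|e IHe]; first by rewrite big_ord_recr big_ord0.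
by rewrite big_ord_recr oddD IHe oddX p_odd orbT addbT.
Qed.

Lemma sigma_pfactor_mod4 p e : prime p -> odd p -> odd e ->
  ~~ (4 %| sigma (p ^ e)) -> p = 1 %[mod 4] /\ e = 1 %[mod 4].
Proof.
move=> p_pr p_odd e_odd; rewrite sigma_pfactor //.
have [k ->] : exists k, e = k.*2.+1.
  by exists e./2; rewrite -[LHS]odd_double_half e_odd.
have -> : \sum_(i < k.*2.+2) p ^ i = (1 + p) * \sum_(i < k.+1) (p ^ 2) ^ i.
  elim: k => [|k IHk].
    by rewrite !big_ord_recr !big_ord0 /= !expn0 expn1; lia.
  rewrite doubleS 2!big_ord_recr IHk [in RHS]big_ord_recr /=.
  rewrite -expnM mul2n doubleS mulnDr (mulnDl _ _ (p ^ _)) mul1n.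
  by rewrite -expnS addnA.
have p_mod4 : p %% 4 = 1 \/ 4 %| 1 + p by lia.
case: p_mod4 => [p_mod4 | p4]; last by rewrite dvdn_mulr.
move=> sig4; split=> //.
have : ~~ (2 %| \sum_(i < k.+1) (p ^ 2) ^ i).
  apply: contra sig4 => sig2; rewrite (_ : 4 = 2 * 2) // dvdn_mul //; lia.
rewrite dvdn2 negbK.
have -> : odd (\sum_(i < k.+1) (p ^ 2) ^ i) = ~~ odd k; last by lia.
elim: k {e_odd sig4} => [|k IHk]; first by rewrite big_ord_recr big_ord0.
by rewrite big_ord_recr oddD IHk !oddX p_odd !orbT addbT.
Qed.

(** * Powers of 3 minus 1 *)

(** [3 ^ h] modulo [m], in binary arithmetic. *)
Fixpoint pow3_mod (h : nat) (m : N) : N :=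
  if h is h'.+1 then N.modulo (3 * pow3_mod h' m) m else N.modulo 1 m.

Lemma N_of_nat_modn a m :
  0 < m -> N.of_nat (a %% m) = N.modulo (N.of_nat a) (N.of_nat m).
Proof.
move=> m_gt0; apply: (N.mod_unique _ _ (N.of_nat (a %/ m))).
  by have := ltn_pmod a m_gt0; lia.
have := divn_eq a m; nia.
Qed.

Lemma pow3_modE h m : 0 < m -> pow3_mod h (N.of_nat m) = N.of_nat (3 ^ h %% m).
Proof.
move=> m_gt0; elim: h => [|h IHh]; first by rewrite expn0 N_of_nat_modn.
rewrite -[LHS]/(N.modulo (3 * pow3_mod h (N.of_nat m)) (N.of_nat m)).
rewrite IHh expnS -modnMmr [RHS]N_of_nat_modn //.
set r := 3 ^ h %% m.
by have -> : N.of_nat (3 * r) = (3 * N.of_nat r)%num by lia.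
Qed.

(** If 3 ^ h = -1 and 3 ^ N = 1 modulo [d] with [N] odd, then raising to the
    powers [N] and [h] gives -1 = 1. *)
Lemma dvdn_pow3_odd d h N :
  odd N -> d %| (3 ^ h).+1 -> d %| (3 ^ N).-1 -> d %| 2.
Proof.
move=> N_odd dh dN.
have d_minus : d %| ((3 ^ h) ^ N).-1.
  by rewrite -expnM mulnC expnM; apply: dvdn_trans dN (dvdn_pred_predX _ _).
have d_plus : d %| ((3 ^ h) ^ N).+1.
  apply: dvdn_trans dh _; have : 0 < 3 ^ h by rewrite expn_gt0.
  move: (3 ^ h) => x x_gt0.
  have -> : N = (2 * N./2).+1 by rewrite mul2n -[LHS]odd_double_half N_odd.
  have -> : (x ^ (2 * N./2).+1).+1 = x * ((x ^ 2) ^ N./2).-1 + x.+1.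
    rewrite expnS expnM; have : 0 < (x ^ 2) ^ N./2 by rewrite !expn_gt0 x_gt0.
    case: (_ ^ _) => // z _ /=; rewrite mulnS; lia.
  rewrite dvdn_add ?dvdnn // dvdn_mull //.
  apply: dvdn_trans (dvdn_pred_predX _ _).
  by rewrite (_ : (x ^ 2).-1 = x.-1 * x.+1) ?dvdn_mull //; nia.
have : 0 < (3 ^ h) ^ N by rewrite !expn_gt0.
move: d_plus d_minus; case: (_ ^ _) => //= z d2 dz _.
by rewrite -(dvdn_addr _ dz) addn2.
Qed.

(** For these primes [p], 3 has even order modulo [p]. *)
Lemma prime_ndvd_pow3_odd p N :
  p \in [:: 29; 31; 37; 41; 43; 53; 61] -> odd N -> ~~ (p %| (3 ^ N).-1).
Proof.
move=> p_in N_odd; apply/negP => pN.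
have [p_gt2 [h ph]] : 2 < p /\ exists h, p %| (3 ^ h).+1.
  have check h0 r : 0 < r -> pow3_mod h0 (N.of_nat r) = N.of_nat r.-1 ->
      r %| (3 ^ h0).+1.
    move=> r_gt0; rewrite pow3_modE // => /Nat2N.inj mod_r.
    apply/dvdnP; exists (3 ^ h0 %/ r).+1.
    by rewrite {1}(divn_eq (3 ^ h0) r) mod_r -addnS prednK // mulSn addnC.
  move: p_in; rewrite !inE.
  case/or4P => [|||/or4P[]] /eqP ->; split=> //.
  (* Each exponent is half the order of 3. *)
  - by exists 14; apply: check.
  - by exists 15; apply: check.
  - by exists 9; apply: check.
  - by exists 4; apply: check.
  - by exists 21; apply: check.
  - by exists 26; apply: check.
  - by exists 5; apply: check.
by have := @dvdn_leq p 2 isT (dvdn_pow3_odd N_odd ph pN); lia.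
Qed.

(** Binary test that [t ^ 2] does not divide [3 ^ t./2 - 1], for [t] prime;
    note that [t./2] is (t - 1) / 2 for [t] odd. *)
Definition sqr_ndvd_pow3_test (t : nat) : bool :=
  prime t ==>
  ~~ N.eqb (pow3_mod t./2 (N.of_nat t * N.of_nat t)) 1.

Lemma sqr_ndvd_pow3_test_true : all sqr_ndvd_pow3_test (iota 29 756).
Proof. by vm_compute. Qed.

Lemma sqr_ndvd_pow3 t :
  prime t -> 29 <= t <= 784 -> ~~ (t ^ 2 %| (3 ^ t./2).-1).
Proof.
move=> t_pr t_range; apply/negP => t2.
have t_in : t \in iota 29 756 by rewrite mem_iota; lia.
have := allP sqr_ndvd_pow3_test_true t t_in.
rewrite /sqr_ndvd_pow3_test t_pr implyTb => /negP; apply; apply/N.eqb_spec.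
have t_gt0 := prime_gt0 t_pr.
have pow_gt0 : 0 < 3 ^ t./2 by rewrite expn_gt0.
have -> : (N.of_nat t * N.of_nat t)%num = N.of_nat (t ^ 2).
  by rewrite -mulnn; lia.
rewrite pow3_modE ?expn_gt0 ?t_gt0 //.
case/dvdnP: t2 => c def_c.
rewrite -(prednK pow_gt0) def_c.
have -> : (c * t ^ 2).+1 = c * t ^ 2 + 1 by rewrite addn1.
by rewrite modnMDl modn_small // -mulnn; nia.
Qed.

Lemma dvdn_pow3_gcdn d m n :
  0 < m -> d %| (3 ^ m).-1 -> d %| (3 ^ n).-1 -> d %| (3 ^ gcdn m n).-1.
Proof.
move=> m_gt0 dm dn; have [a _ /dvdnP[k def_km]] := Bezoutl n m_gt0.
have dmk : d %| (3 ^ (gcdn m n + a * n)).-1.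
  by rewrite def_km mulnC expnM; apply: dvdn_trans dm (dvdn_pred_predX _ _).
have dna : d %| (3 ^ (a * n)).-1.
  by rewrite mulnC expnM; apply: dvdn_trans dn (dvdn_pred_predX _ _).
move: dmk; rewrite expnD.
have : 0 < 3 ^ gcdn m n by rewrite expn_gt0.
have : 0 < 3 ^ (a * n) by rewrite expn_gt0.
case: (3 ^ (a * n)) dna => // y dy _; case: (3 ^ gcdn m n) => // x _.
have -> : (x.+1 * y.+1).-1 = x + x.+1 * y by lia.
by rewrite /= dvdn_addl // dvdn_mull.
Qed.

(** If (3 ^ N - 1) / 2 were a power of [t], so would be (3 ^ g - 1) / 2 for
    g = gcd (t - 1, N), an odd number dividing (t - 1) / 2. By [sqr_ndvd_pow3]
    the latter power is [t] itself, whereas (3 ^ g - 1) / 2 is 1, 13, 121 or at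
    least 1093. *)
Lemma repunit3_neq_pfactor t N y :
  prime t -> 29 <= t <= 784 -> odd N -> 1 < N -> (3 ^ N).-1 <> 2 * t ^ y.
Proof.
move=> t_pr t_range N_odd N_gt1 eqN.
have t_odd : odd t by apply: contraTT t_pr => ?; apply/negP => /even_prime; lia.
have t_gt0 := prime_gt0 t_pr.
have y_gt0 : 0 < y.
  rewrite lt0n; apply: contra_eqN eqN => /eqP ->.
  have : 3 ^ 2 <= 3 ^ N by rewrite leq_exp2l.
  by apply: contraTneq; rewrite expn0; lia.
have t_N : t %| (3 ^ N).-1 by rewrite eqN dvdn_mull // dvdn_exp.
have t_t1 : t %| (3 ^ t.-1).-1.
  have : t %| 3 * (3 ^ t.-1).-1.
    have := fermat_little 3 t_pr; move/eqP; rewrite eqn_mod_dvd; last first.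
      by rewrite -[X in X <= _]expn1 leq_exp2l.
    suff -> : 3 * (3 ^ t.-1).-1 = 3 ^ t - 3 by [].
    by rewrite -subn1 mulnBr muln1 -expnS prednK.
  rewrite Gauss_dvdr // prime_coprime // dvdn_prime2 //; lia.
have t1_gt0 : 0 < t.-1 by lia.
have := dvdn_pow3_gcdn t1_gt0 t_t1 t_N.
have := dvdn_gcdl t.-1 N; have := dvdn_gcdr t.-1 N.
move: (gcdn _ _) => g g_N g_t1 t_g.
have g_odd : odd g by apply: dvdn_odd g_N _.
have g_half : g %| t./2.
  have : g %| 2 * t./2.
    apply: dvdn_trans g_t1 _.
    by rewrite -[in t.-1](odd_double_half t) t_odd mul2n.
  by rewrite Gauss_dvdr // coprimen2.
have [u def_u] : exists u, (3 ^ g).-1 = 2 * u.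
  have : 2 %| (3 ^ g).-1 by apply: (dvdn_pred_predX 3 g).
  by case/dvdnP => u ->; exists u; rewrite mulnC.
have [j _ def_j] : exists2 j, j <= y & u = t ^ j.
  apply/(dvdn_pfactor _ _ t_pr); rewrite -(@dvdn_pmul2l 2) // -def_u -eqN.
  case/dvdnP: g_N => k ->.
  by rewrite mulnC expnM dvdn_pred_predX.
have t_u : t %| u by move: t_g; rewrite def_u Gauss_dvdr // coprimen2.
have j_eq1 : j = 1.
  have j_gt0 : j != 0.
    by apply/eqP => j0; move: t_u; rewrite def_j j0 dvdn1; lia.
  have : j < 2; last by lia.
  rewrite ltnNge; apply/negP => j_ge2.
  have := sqr_ndvd_pow3 t_pr t_range; apply/negP; rewrite negbK.
  have /dvdnP[k ->] := g_half.
  rewrite mulnC expnM; apply: dvdn_trans (dvdn_pred_predX _ _).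
  by rewrite def_u def_j dvdn_mull // dvdn_exp2l.
rewrite def_j j_eq1 expn1 in def_u.
have [g_ge7 | g_lt7] := leqP 7 g.
  have : 3 ^ 7 <= 3 ^ g by rewrite leq_exp2l.
  by move: (3 ^ g) def_u => z; clear -t_range; lia.
have g_in : g \in [:: 1; 3; 5].
  have small k : odd k -> k < 7 -> k \in [:: 1; 3; 5].
    by do 7?[case: k => [|k] //].
  exact: small.
have : t \in [:: 1; 13; 121].
  have def_t : t = (3 ^ g).-1 %/ 2 by rewrite def_u mulKn.
  by rewrite def_t; move: g_in; rewrite !inE => /or3P[] /eqP ->.
by rewrite !inE => /or3P[] /eqP t_eq; move: t_range t_pr; rewrite t_eq.
Qed.

(** The last hypothesis amounts to (p - 28)(q - 28) <= 756 = 28 * 27. *)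
Lemma two_primes_bound p q :
  prime p -> prime q -> 29 <= p -> p < q ->
  28 * (p.-1 * q.-1) <= 27 * (p * q) ->
  [/\ p \in [:: 29; 31; 37; 41; 43; 47], q <= 784 & p = 47 -> q <= 67].
Proof.
move=> p_pr q_pr p_ge29 lt_pq bound.
have [p' def_p] : exists p', p = p' + 28 by exists (p - 28); lia.
have [q' def_q] : exists q', q = q' + 28 by exists (q - 28); lia.
have {}bound : p' * q' <= 756 by move: bound; rewrite def_p def_q; nia.
have p_lt : p' < 28 by rewrite ltnNge; apply/negP => ?; nia.
have p_in : p \in [:: 29; 31; 37; 41; 43; 47; 53].
  (* p < q and (p - 28)(q - 28) <= 756 = 27 * 28 give p <= 55. *)
  have primes_check : all (fun r => prime r ==>
      (r \in [:: 29; 31; 37; 41; 43; 47; 53])) (iota 29 27) by [].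
  have p_in : p \in iota 29 27 by rewrite mem_iota; lia.
  by have := allP primes_check p p_in; rewrite p_pr.
have p_neq53 : p != 53.
  (* The pair (53, q) would force q < 59, but 59 is the next prime. *)
  apply/eqP => p53; have no_prime : all (predC prime) (iota 54 5) by [].
  have q_in : q \in iota 54 5 by rewrite mem_iota; nia.
  by have := allP no_prime q q_in; rewrite /= q_pr.
split; [|nia|nia].
by move: p_in; rewrite !inE (negPf p_neq53) orbF.
Qed.

(** One of [p] and [q] never divides [3 ^ N - 1]. This is the smaller one unless
    it is 47; since 47 is not 1 modulo 4 it is then [p], and [q] is 53 or 61. *)
Lemma repunit3_two_primes p q N x y :
  prime p -> prime q -> p <> q -> 29 <= p -> 29 <= q -> q = 1 %[mod 4] ->
  28 * (p.-1 * q.-1) <= 27 * (p * q) ->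
  odd N -> 1 < N -> (3 ^ N).-1 <> 2 * (p ^ x * q ^ y).
Proof.
move=> p_pr q_pr neq_pq p_ge29 q_ge29 q_mod4 bound N_odd N_gt1 eqN.
have drop r z w : ~~ (r %| (3 ^ N).-1) -> (3 ^ N).-1 = 2 * (r ^ z * w) ->
    (3 ^ N).-1 = 2 * w.
  case: z => [|z] r_N eq_r; first by rewrite eq_r expn0 mul1n.
  by case/negP: r_N; rewrite eq_r expnS -mulnA dvdn_mull // dvdn_mulr.
have only_q : p \in [:: 29; 31; 37; 41; 43; 53; 61] -> q <= 784 -> False.
  move=> p_in q_le; have q_range : 29 <= q <= 784 by rewrite q_ge29.
  apply: (repunit3_neq_pfactor q_pr q_range N_odd N_gt1 (y := y)).
  exact: drop (prime_ndvd_pow3_odd p_in N_odd) eqN.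
have only_p : q \in [:: 29; 31; 37; 41; 43; 53; 61] -> p <= 784 -> False.
  move=> q_in p_le; have p_range : 29 <= p <= 784 by rewrite p_ge29.
  apply: (repunit3_neq_pfactor p_pr p_range N_odd N_gt1 (y := x)).
  apply: (drop q y _ (prime_ndvd_pow3_odd q_in N_odd)).
  by rewrite eqN [p ^ x * _]mulnC.
case: (ltngtP p q) => [lt_pq | lt_qp | //].
  have [p_in q_le p47] := two_primes_bound p_pr q_pr p_ge29 lt_pq bound.
  have [eq_p | neq_p] := eqVneq p 47.
    apply: only_p; last by rewrite eq_p.
    have q_check : all (fun r => prime r && (r %% 4 == 1) ==>
      (r \in [:: 29; 31; 37; 41; 43; 53; 61])) (iota 48 20) by [].
    have q_in : q \in iota 48 20 by have := p47 eq_p; rewrite mem_iota; lia.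
    by have := allP q_check q q_in; rewrite q_pr q_mod4.
  apply: only_q q_le; move: p_in; rewrite !inE (negPf neq_p) orbF.
  by case/or4P => [||| /orP[]] /eqP ->.
have [|q_in p_le _] := two_primes_bound q_pr p_pr q_ge29 lt_qp.
  by rewrite [q.-1 * _]mulnC [q * p]mulnC.
apply: only_p p_le; move: q_in q_mod4; rewrite !inE.
by case/or4P => [||| /or3P[]] /eqP ->.
Qed.

(** * Numbers of abundancy index 7/3 *)

Lemma sigma_dvdn_le d n :
  0 < n -> d %| n -> sigma d * n <= sigma n * d.
Proof.
move=> n_gt0 d_n; have [-> // | /eqP neq_dn] := eqVneq d n.
exact/ltnW/sigma_dvdn_ltn.
Qed.

Lemma abundancy_eq_7_3 n :
  0 < n -> abundancy n = (7 / 3)%R -> 3 * sigma n = 7 * n.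
Proof.
move=> n_gt0 /eqP.
rewrite /abundancy GRing.eqr_div ?Num.Theory.pnatr_eq0 -?lt0n //.
by rewrite -!GRing.natrM Num.Theory.eqr_nat mulnC => /eqP ->.
Qed.

Lemma prod_nth (l : seq nat) (F : nat -> nat) :
  \prod_(p <- l) F p = \prod_(i < size l) F (nth 0 l i).
Proof. by rewrite (big_nth 0) big_mkord. Qed.

(** * The odd case *)

Section OddCase.

Variable n : nat.
Hypotheses (n_gt0 : 0 < n) (n_odd : odd n) (sigma_n : 3 * sigma n = 7 * n).

Lemma odd_case_dvdn_bound d : d %| n -> 3 * sigma d <= 7 * d.
Proof.
move=> d_n; have le_sigma := sigma_dvdn_le n_gt0 d_n.
by rewrite -(leq_pmul2r n_gt0) -mulnA mulnAC -sigma_n -mulnA leq_mul2l.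
Qed.

Let prime_odd p : p \in primes n -> odd p.
Proof. by rewrite mem_primes => /and3P[_ _ /dvdn_odd]; apply. Qed.

Lemma odd_case_exponents p : p \in primes n -> ~~ odd (logn p n).
Proof.
move=> p_n; have p_odd := prime_odd p_n.
move: p_n; rewrite mem_primes => /and3P[p_pr _ _].
rewrite -(odd_sigma_pfactor _ p_pr p_odd).
apply: dvdn_odd (sigma_pfactor_dvdn p_pr n_gt0) _.
by have : odd (3 * sigma n) by [rewrite sigma_n oddM n_odd]; rewrite oddM.
Qed.

Lemma odd_case_logn_ge2 p : p \in primes n -> 2 <= logn p n.
Proof.
move=> p_n; have := odd_case_exponents p_n.
by have := p_n; rewrite -logn_gt0; case: (logn p n) => [|[]].
Qed.

Lemma odd_case_mem3 : 3 \in primes n.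
Proof.
rewrite mem_primes n_gt0 /=; have : 3 %| 7 * n by rewrite -sigma_n dvdn_mulr.
by rewrite Gauss_dvdr.
Qed.

Lemma odd_case_upper_bound :
  14 * \prod_(p <- rem 3 (primes n)) p.-1
    <= 9 * \prod_(p <- rem 3 (primes n)) p.
Proof.
have := sigma_upper_bound n_gt0.
rewrite !(big_rem 3 odd_case_mem3) /=.
move: (\prod_(p <- _) _) (\prod_(p <- _) _) => A B bound.
by rewrite -(leq_pmul2l n_gt0); move: sigma_n bound; clear; nia.
Qed.

End OddCase.

(** The hypothesis on products says that 3/2 times the product of p / (p - 1)
    over [l] is at least 7/3. *)
Lemma sorted_primes_bound (l : seq nat) :
  sorted ltn l -> all (fun p => prime p && (3 < p)) l -> size l <= 3 ->
  14 * \prod_(p <- l) p.-1 <= 9 * \prod_(p <- l) p ->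
  l = [:: 5; 7; 11] \/ l = [:: 5; 7; 13].
Proof.
have composite p : prime p && (3 < p) ->
    5 <= p /\ p \notin [:: 6; 8; 9; 10; 12; 14; 15; 16].
  case/andP => p_pr p_gt3; split; last first.
    apply/negP => p_in; move: p_pr; apply/negP.
    by apply: (allP (_ : all (predC prime) _) p p_in).
  by have : p != 4 by [apply: contraTneq p_pr => ->]; lia.
case: l => [|p [|q [|r [|]]]] //=; rewrite ?big_cons ?big_nil //.
- by rewrite !muln1 andbT => _ /composite[p_ge5 _] _; lia.
- rewrite !muln1 !andbT => lt_pq /andP[/composite[p_ge5 _] /composite[_]].
  rewrite !inE => q_neq _ bound; exfalso.
  have q_ge7 : 7 <= q by lia.
  have [x def_p] : exists x, p = x + 5 by exists (p - 5); lia.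
  have [y def_q] : exists y, q = y + 7 by exists (q - 7); lia.
  by move: bound; rewrite def_p def_q; nia.
rewrite !muln1 !andbT => /andP[lt_pq lt_qr].
case/and3P => /composite[p_ge5 p_neq] /composite[_ q_neq] /composite[_ r_neq] _.
rewrite !inE in p_neq q_neq r_neq.
have shift c m : c <= m -> exists x, m = x + c.
  by move=> le_cm; exists (m - c); rewrite subnK.
have [p_gt5 | p_le5] := ltnP 5 p.
  have [x ->] : exists x, p = x + 7 by apply: shift; lia.
  have [y ->] : exists y, q = y + 11 by apply: shift; lia.
  have [z ->] : exists z, r = z + 13 by apply: shift; lia.
  by clear; nia.
have -> : p = 5 by lia.
have [q_gt7 | q_le7] := ltnP 7 q.
  have [y ->] : exists y, q = y + 11 by apply: shift; lia.
  have [z ->] : exists z, r = z + 13 by apply: shift; lia.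
  by clear; nia.
have -> : q = 7 by lia.
move=> bound; have : r = 11 \/ r = 13 by lia.
by case=> ->; [left | right].
Qed.

Section OddCase4.

Variables n r : nat.
Hypotheses (n_gt0 : 0 < n) (n_odd : odd n) (sigma_n : 3 * sigma n = 7 * n).
Hypotheses (r_eq : r = 11 \/ r = 13) (primes_n : primes n = [:: 3; 5; 7; r]).

Let r_pr : prime r. Proof. by case: r_eq => ->. Qed.

Let logn_ge2 p : p \in [:: 3; 5; 7; r] -> 2 <= logn p n.
Proof. by rewrite -primes_n; exact: odd_case_logn_ge2. Qed.

Let logn_even p : p \in [:: 3; 5; 7; r] -> ~~ odd (logn p n).
Proof. by rewrite -primes_n; exact: odd_case_exponents. Qed.

(** With 3 to the exponent 2 only, the abundancy index of [n] is less than
    13/9 * 5/4 * 7/6 * r/(r - 1) < 7/3. *)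
Lemma odd_case4_logn3 : 4 <= logn 3 n.
Proof.
have := logn_even (mem_head _ _); have := logn_ge2 (mem_head _ _).
have [log3 _ _ | ] := eqVneq (logn 3 n) 2; last by lia.
exfalso; have := sigma_primes n_gt0; have := prod_primes n_gt0.
rewrite primes_n !big_cons !big_nil log3 !muln1.
have -> : sigma (3 ^ 2) = 13 by rewrite sigma_pfactor // !big_ord_recr big_ord0.
have upper p e : prime p -> p.-1 * sigma (p ^ e) <= p * p ^ e.
  by move=> p_pr; rewrite sigma_pfactor // -predn_exp -expnS leq_pred.
have := upper 5 (logn 5 n) isT; have := upper 7 (logn 7 n) isT.
have := upper r (logn r n) r_pr.
have : 0 < 5 ^ logn 5 n by rewrite expn_gt0.
have : 0 < 7 ^ logn 7 n by rewrite expn_gt0.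
have : 0 < r ^ logn r n by rewrite expn_gt0 prime_gt0.
move: (5 ^ _) (7 ^ _) (r ^ _) => x y z z_gt0 y_gt0 x_gt0.
move: (sigma x) (sigma y) (sigma z) => sx sy sz bz by_ bx def_n def_sigma.
have bxyz := leq_mul bx (leq_mul by_ bz).
have xyz_gt0 : 0 < x * (y * z) by rewrite !muln_gt0 x_gt0 y_gt0.
have eq_prod : 39 * (sx * (sy * sz)) = 63 * (x * (y * z)).
  by move: sigma_n; rewrite def_sigma def_n; lia.
have {}bxyz : 24 * r.-1 * (sx * (sy * sz)) <= 35 * r * (x * (y * z)).
  by move: bxyz; congr (_ <= _); nia.
move: bxyz eq_prod xyz_gt0; move: (sx * _) (x * _) => S P.
by clear -r_eq; case: r_eq => -> /=; lia.
Qed.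

(** Exponent 2 at 5 would bring in the prime 31 = sigma 25. *)
Lemma odd_case4_logn5 : 4 <= logn 5 n.
Proof.
have m5 : 5 \in [:: 3; 5; 7; r] by [].
have := logn_even m5; have := logn_ge2 m5.
have [log5 _ _ | ] := eqVneq (logn 5 n) 2; last by lia.
have := @sigma_pfactor_dvdn 5 n isT n_gt0; rewrite log5.
have -> : sigma (5 ^ 2) = 31 by rewrite sigma_pfactor // !big_ord_recr big_ord0.
move=> d31; have : 31 %| 7 * n by rewrite -sigma_n dvdn_mull.
rewrite Gauss_dvdr // => n31.
have : 31 \in primes n by rewrite mem_primes n_gt0.
by rewrite primes_n; case: r_eq => ->.
Qed.

(** The divisor [d] below has abundancy index greater than 7/3. *)
Lemma odd_case4_false : False.
Proof.
pose d := 3 ^ 4 * (5 ^ 4 * (7 ^ 2 * r ^ 2)).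
have co_r p : p \in [:: 3; 5; 7] -> coprime p r.
  by case: r_eq => ->; rewrite !inE => /or3P[] /eqP ->.
have c3 : coprime (3 ^ 4) (5 ^ 4 * (7 ^ 2 * r ^ 2)).
  by rewrite !coprimeMr !coprime_pexpl ?coprime_pexpr ?co_r.
have c5 : coprime (5 ^ 4) (7 ^ 2 * r ^ 2).
  by rewrite !coprimeMr !coprime_pexpl ?coprime_pexpr ?co_r.
have c7 : coprime (7 ^ 2) (r ^ 2).
  by rewrite !coprime_pexpl ?coprime_pexpr ?co_r.
have d_n : d %| n.
  rewrite /d (Gauss_dvd _ c3) (Gauss_dvd _ c5) (Gauss_dvd _ c7).
  rewrite !pfactor_dvdn // odd_case4_logn3 odd_case4_logn5.
  by rewrite !logn_ge2 ?inE ?eqxx ?orbT.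
have := odd_case_dvdn_bound n_gt0 sigma_n d_n.
rewrite /d (sigma_coprime c3) (sigma_coprime c5) (sigma_coprime c7).
rewrite !sigma_pfactor // !big_ord_recr !big_ord0 /= !expn0.
have -> : 3 ^ 4 = 81 by [].
have -> : 5 ^ 4 = 625 by [].
by case: r_eq => ->; rewrite !expnS !expn0; lia.
Qed.

End OddCase4.

Lemma odd_case_size n :
  0 < n -> odd n -> 3 * sigma n = 7 * n -> 4 <= size (rem 3 (primes n)).
Proof.
move=> n_gt0 n_odd sigma_n; rewrite ltnNge; apply/negP => small.
have n3 := odd_case_mem3 n_gt0 sigma_n.
have sorted_l : sorted ltn (rem 3 (primes n)).
  by apply: (subseq_sorted ltn_trans (rem_subseq _ _)); apply: sorted_primes.
have l_gt3 : all (fun p => prime p && (3 < p)) (rem 3 (primes n)).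
  apply/allP => p; rewrite mem_rem_uniq ?primes_uniq // !inE mem_primes.
  case/andP => p_neq3 /and3P[p_pr _ p_n]; rewrite p_pr /=.
  have p_odd : odd p := dvdn_odd p_n n_odd.
  have := prime_gt1 p_pr; move: p_neq3 p_odd.
  by case: p {p_pr p_n} => [|[|[|[]]]].
have upper := odd_case_upper_bound n_gt0 sigma_n.
have [r r_eq primes_n] :
    exists2 r, r = 11 \/ r = 13 & primes n = [:: 3; 5; 7; r].
  have perm_n : perm_eq (primes n) (3 :: rem 3 (primes n)).
    exact: perm_to_rem.
  have eq_primes l :
      rem 3 (primes n) = l -> sorted ltn (3 :: l) -> primes n = 3 :: l.
    move=> def_l sorted_3l.
    apply: (irr_sorted_eq ltn_trans ltnn (sorted_primes n) sorted_3l) => p.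
    by rewrite (perm_mem perm_n) def_l.
  case: (sorted_primes_bound sorted_l l_gt3 small upper) => def_l.
    by exists 11; [left | rewrite (eq_primes _ def_l)].
  by exists 13; [right | rewrite (eq_primes _ def_l)].
exact: odd_case4_false n_gt0 n_odd sigma_n r_eq primes_n.
Qed.

(** * The even case *)

Section EvenCase.

(** Here [m] stands for half of an even number of abundancy index 7/3. *)
Variable m : nat.
Hypotheses (m_gt0 : 0 < m) (m_odd : odd m) (sigma_m : 9 * sigma m = 14 * m).

Lemma even_case_dvdn_bound d : d %| m -> 9 * sigma d <= 14 * d.
Proof.
move=> d_m; have le_sigma := sigma_dvdn_le m_gt0 d_m.
by rewrite -(leq_pmul2r m_gt0) -mulnA mulnAC -sigma_m -mulnA leq_mul2l.
Qed.

Lemma even_case_neq117 : m <> 117 -> ~~ (117 %| m).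
Proof.
move=> m_neq; apply/negP => m117.
have lt_sigma := sigma_dvdn_ltn m_gt0 m117 (nesym m_neq).
suff sigma_117 : sigma 117 = 182.
  by move: sigma_m lt_sigma; rewrite sigma_117; clear; lia.
rewrite (_ : 117 = 3 ^ 2 * 13 ^ 1) // sigma_coprime // !sigma_pfactor //.
by rewrite !big_ord_recr !big_ord0.
Qed.

Let prime_odd p : p \in primes m -> odd p.
Proof. by rewrite mem_primes => /and3P[_ _ /dvdn_odd]; apply. Qed.

Let sigma_m_even : ~~ odd (sigma m).
Proof.
by have : ~~ odd (9 * sigma m) by [rewrite sigma_m oddM]; rewrite oddM.
Qed.

(** As [sigma m] is twice an odd number, exactly one prime has an odd
    exponent. *)
Lemma even_case_odd_exponent :
  exists q, [/\ q \in primes m, odd (logn q m), q = 1 %[mod 4],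
    logn q m = 1 %[mod 4] &
    forall p, p \in primes m -> p <> q -> ~~ odd (logn p m)].
Proof.
have [q q_m q_odd] : exists2 q, q \in primes m & odd (logn q m).
  apply/hasP; rewrite -[has _ _]negbK -all_predC; apply/negP => /allP even_exp.
  move/negP: sigma_m_even; apply; rewrite sigma_primes // big_seq.
  apply: (big_ind (fun x => odd x)) => // [x y x_odd y_odd | p p_m].
    by rewrite oddM x_odd.
  have p_pr : prime p by move: p_m; rewrite mem_primes => /andP[].
  rewrite (odd_sigma_pfactor _ p_pr (prime_odd p_m)).
  exact: (even_exp p p_m).
have q_pr : prime q by move: q_m; rewrite mem_primes => /andP[].
have [m1 [m1_gt0 co_qm1 def_m def_sigma]] := sigma_split_pfactor q_pr m_gt0.
have sig4 : ~~ (4 %| sigma m) by lia.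
have sigq_even : 2 %| sigma (q ^ logn q m).
  by rewrite dvdn2 odd_sigma_pfactor ?q_odd // prime_odd.
have [q_mod4 e_mod4] : q = 1 %[mod 4] /\ logn q m = 1 %[mod 4].
  apply: sigma_pfactor_mod4 q_pr (prime_odd q_m) q_odd _.
  by apply: contra sig4 => sig4; rewrite def_sigma dvdn_mulr.
exists q; split=> // p p_m neq_pq.
have p_pr : prime p by move: p_m; rewrite mem_primes => /andP[].
have sig1_odd : odd (sigma m1).
  apply: contraR sig4; rewrite -dvdn2 => sig1_even.
  by rewrite def_sigma (_ : 4 = 2 * 2) // dvdn_mul.
have -> : logn p m = logn p m1.
  have qe_gt0 : 0 < q ^ logn q m by rewrite expn_gt0 prime_gt0.
  rewrite [in LHS]def_m (lognM _ qe_gt0 m1_gt0) lognX (logn_prime _ q_pr).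
  by have /eqP/negPf -> := neq_pq; rewrite muln0.
rewrite -(odd_sigma_pfactor _ p_pr (prime_odd p_m)).
exact: dvdn_odd (sigma_pfactor_dvdn p_pr m1_gt0) sig1_odd.
Qed.

Lemma even_case_9dvdn : 9 %| m.
Proof.
have : 9 %| 14 * m by rewrite -sigma_m dvdn_mulr.
by rewrite Gauss_dvdr.
Qed.

(** Exponent 2 would bring in the prime 13 = sigma 9, and exponent 4 the factor
    121 = sigma 81. *)
Lemma even_case_logn3 : m <> 117 -> ~~ odd (logn 3 m) -> 6 <= logn 3 m.
Proof.
move=> m_neq even3.
have v_ge2 : 2 <= logn 3 m by rewrite -pfactor_dvdn // even_case_9dvdn.
have sig_v d : sigma (3 ^ logn 3 m) = d -> coprime d 14 -> d %| m.
  move=> def_d co_d; rewrite -(Gauss_dvdr _ co_d) -sigma_m dvdn_mull //.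
  by rewrite -def_d sigma_pfactor_dvdn.
have v_neq2 : logn 3 m != 2.
  apply/eqP => v2; have /negP := even_case_neq117 m_neq; apply.
  have m13 : 13 %| m.
    by apply: sig_v; rewrite // v2 sigma_pfactor // !big_ord_recr big_ord0.
  by rewrite (_ : 117 = 9 * 13) // Gauss_dvd // even_case_9dvdn.
have v_neq4 : logn 3 m != 4.
  apply/eqP => v4; have m121 : 11 ^ 2 %| m.
    by apply: sig_v; rewrite // v4 sigma_pfactor // !big_ord_recr big_ord0.
  have m81 : 3 ^ 4 %| m by rewrite pfactor_dvdn // v4.
  have co : coprime (3 ^ 4) (11 ^ 2) by rewrite coprime_pexpl ?coprime_pexpr.
  have := @even_case_dvdn_bound (3 ^ 4 * 11 ^ 2).
  rewrite Gauss_dvd // m81 m121 => /(_ isT).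
  rewrite (sigma_coprime co) !sigma_pfactor // !big_ord_recr !big_ord0 /=.
  by rewrite !expnS !expn0; clear; lia.
by move: v_ge2 v_neq2 v_neq4 even3; move: (logn 3 m); clear; lia.
Qed.

(** The abundancy index of 3 ^ 6 * p exceeds 14/9 for p < 27. *)
Lemma even_case_prime_ge29 p :
  6 <= logn 3 m -> p \in primes m -> p <> 3 -> 29 <= p.
Proof.
move=> v_ge6 p_m neq_p3; move: p_m; rewrite mem_primes => /and3P[p_pr _ p_m].
have co : coprime (3 ^ 6) p.
  by rewrite coprime_pexpl // prime_coprime // dvdn_prime2 //; apply/eqP/nesym.
have m_d : 3 ^ 6 * p %| m by rewrite Gauss_dvd // p_m pfactor_dvdn // v_ge6.
have := even_case_dvdn_bound m_d; rewrite (sigma_coprime co).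
have -> : sigma (3 ^ 6) = 1093.
  by rewrite sigma_pfactor // !big_ord_recr big_ord0.
have -> : sigma p = p.+1.
  rewrite -{1}(expn1 p) sigma_pfactor // !big_ord_recr big_ord0 /=.
  by rewrite expn0 expn1.
have -> : 3 ^ 6 = 729 by [].
move=> bound; have p_ge27 : 27 <= p by move: bound; clear; lia.
have : p != 27 by apply: contraTneq p_pr => ->.
have : p != 28 by apply: contraTneq p_pr => ->.
by move: p_ge27; clear; lia.
Qed.

Lemma even_case_upper_bound q :
  3 \in primes m -> q \in rem 3 (primes m) ->
  28 * (q.-1 * \prod_(p <- rem q (rem 3 (primes m))) p.-1)
    <= 27 * (q * \prod_(p <- rem q (rem 3 (primes m))) p).
Proof.
move=> m3 m_q; have := sigma_upper_bound m_gt0.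
rewrite !(big_rem 3 m3) !(big_rem q m_q) /=.
move: (\prod_(p <- _) _) (\prod_(p <- _) _) => A B.
move: (q.-1 * A) (q * B) => QA QB bound.
by rewrite -(leq_pmul2l m_gt0); move: sigma_m bound; clear; nia.
Qed.

(** [sigma (3 ^ v)] divides [14 * m] and is prime to 2, 3 and 7, so that it
    only has the prime factors of [m] other than 3. *)
Lemma even_case_sigma_pow3 p q v e f :
  ~~ odd v -> m = 3 ^ v * (p ^ e * q ^ f) -> prime p -> prime q -> p <> q ->
  p <> 3 -> q <> 3 ->
  exists x y, (3 ^ v.+1).-1 = 2 * (p ^ x * q ^ y).
Proof.
move=> v_even def_m p_pr q_pr neq_pq neq_p3 neq_q3.
have def_s : (3 ^ v.+1).-1 = 2 * sigma (3 ^ v).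
  by rewrite predn_exp sigma_pfactor.
have co3 r k : prime r -> r <> 3 -> coprime (3 ^ v) (r ^ k).
  move=> r_pr /eqP neq_r3; apply/coprimeXl/coprimeXr.
  by rewrite prime_coprime // dvdn_prime2 // eq_sym.
have co_pq : coprime (p ^ e) (q ^ f).
  apply/coprimeXl/coprimeXr; rewrite prime_coprime // dvdn_prime2 //.
  exact/eqP.
have s_m : sigma (3 ^ v) %| sigma m.
  by rewrite def_m sigma_coprime ?dvdn_mulr // coprimeMr !co3.
set s := sigma (3 ^ v) in def_s s_m *.
have co_s2 : coprime s 2 by rewrite coprimen2 odd_sigma_pfactor.
have co_s7 : coprime s 7.
  rewrite coprime_sym prime_coprime //; apply/negP => s7.
  (* 7 divides 3 ^ 3 + 1. *)
  suff : 7 %| 2 by [].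
  apply: (@dvdn_pow3_odd 7 3 v.+1) => //.
  by rewrite def_s dvdn_mull.
have co_s3 : coprime s (3 ^ v).
  apply: coprimeXr; rewrite coprime_sym prime_coprime // /s sigma_pfactor //.
  rewrite big_ord_recl expn0 dvdn_addl // dvdn_sum // => i _.
  by rewrite expnS dvdn_mulr.
have : s %| 14 * m by rewrite -sigma_m dvdn_mull.
rewrite (_ : 14 = 2 * 7) // -mulnA Gauss_dvdr // Gauss_dvdr //.
rewrite def_m Gauss_dvdr //.
move/(dvdn_coprime_mul co_pq) => split_s; rewrite def_s split_s.
have /(dvdn_pfactor _ _ p_pr)[x _ ->] := dvdn_gcdr s (p ^ e).
have /(dvdn_pfactor _ _ q_pr)[y _ ->] := dvdn_gcdr s (q ^ f).
by exists x, y.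
Qed.

End EvenCase.

(** Were there a single prime [p] besides 3 and [q], then
    [3 ^ (logn 3 m).+1 - 1] would be twice a product of powers of [p] and
    [q]. *)
Lemma even_case_size m q :
  0 < m -> odd m -> 9 * sigma m = 14 * m -> m <> 117 ->
  q \in primes m -> q = 1 %[mod 4] ->
  (forall p, p \in primes m -> p <> q -> ~~ odd (logn p m)) ->
  2 <= size (rem q (rem 3 (primes m))).
Proof.
move=> m_gt0 m_odd sigma_m m_neq m_q q_mod4 exp_even.
have neq_q3 : q <> 3 by move=> q3; rewrite q3 in q_mod4.
have m3 : 3 \in primes m.
  by rewrite mem_primes m_gt0 /=; apply: dvdn_trans (even_case_9dvdn sigma_m).
have v_even : ~~ odd (logn 3 m) by apply: exp_even (nesym neq_q3).
have v_ge6 := even_case_logn3 m_gt0 sigma_m m_neq v_even.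
have ge29 := even_case_prime_ge29 m_gt0 sigma_m v_ge6.
have m_q3 : q \in rem 3 (primes m).
  by rewrite mem_rem_uniq ?primes_uniq // !inE m_q andbT; apply/eqP.
have upper := even_case_upper_bound m_gt0 sigma_m m3 m_q3.
have q_pr : prime q by move: m_q; rewrite mem_primes => /andP[].
have q_ge29 : 29 <= q := ge29 q m_q neq_q3.
have mem_l p : p \in rem q (rem 3 (primes m)) ->
    [/\ p <> q, p <> 3 & p \in primes m].
  rewrite mem_rem_uniq ?rem_uniq ?primes_uniq // !inE.
  rewrite mem_rem_uniq ?primes_uniq //.
  by rewrite !inE => /and3P[/eqP ? /eqP ? ?].
have := prod_primes m_gt0; rewrite (big_rem 3 m3) (big_rem q m_q3) /=.
move: mem_l upper; case: (rem q _) => [|p [|//]] //= mem_l.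
  by rewrite !big_nil !muln1; clear -q_ge29; lia.
rewrite !big_seq1 => upper def_m.
have [neq_pq neq_p3 m_p] := mem_l p (mem_head _ _).
have p_pr : prime p by move: m_p; rewrite mem_primes => /andP[].
rewrite [q ^ _ * _]mulnC in def_m.
have [x [y eq_pow]] :=
  even_case_sigma_pow3 sigma_m v_even def_m p_pr q_pr neq_pq neq_p3 neq_q3.
rewrite [q.-1 * _]mulnC [q * _]mulnC in upper.
have N_gt1 : 1 < (logn 3 m).+1 by rewrite ltnS (leq_trans _ v_ge6).
exfalso; have p_ge29 : 29 <= p := ge29 p m_p neq_p3.
by apply: (repunit3_two_primes _ _ neq_pq _ _ _ upper _ N_gt1 eq_pow).
Qed.

Theorem theorem3p1 (n : nat) (n_gt0 : 0 < n)
    (n_neq12 : n <> 12) (n_neq234 : n <> 234)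
    (In : abundancy n = (7 / 3)%R) :
  (odd n ->
     exists (k : nat) (p : 'I_k -> nat) (a : nat) (e : 'I_k -> nat),
       [/\ 4 <= k,
           injective p,
           forall i, prime (p i) /\ 3 < p i,
           0 < a /\ (forall i, 0 < e i) &
           n = 3 ^ (2 * a) * \prod_(i < k) p i ^ (2 * e i)])
  /\
  (~~ odd n ->
     exists (k : nat) (q : nat) (p : 'I_k -> nat)
            (a e : nat) (f : 'I_k -> nat),
       [/\ 2 <= k,
           injective p /\ (forall i, p i <> q),
           (prime q /\ 29 <= q) /\ (forall i, prime (p i) /\ 29 <= p i),
           [/\ 3 <= a, 0 < e, forall i, 0 < f i,
               q = 1 %[mod 4] & e = 1 %[mod 4]] &
           n = 2 * 3 ^ (2 * a) * q ^ e * \prod_(i < k) p i ^ (2 * f i)]).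
Proof.
have sigma_n := abundancy_eq_7_3 n_gt0 In.
have half_double e : ~~ odd e -> 2 * e./2 = e.
  by move=> e_even; rewrite mul2n even_halfK.
have half_gt0 m p : p \in primes m -> ~~ odd (logn p m) -> 0 < (logn p m)./2.
  by rewrite -logn_gt0; case: (logn p m) => [|[]].
have nth_inj (l : seq nat) :
    uniq l -> injective (fun i : 'I_(size l) => nth 0 l i).
  by move=> l_uniq i j /eqP; rewrite nth_uniq // => /eqP/val_inj.
split=> n_parity.
- have n3 := odd_case_mem3 n_gt0 sigma_n.
  have exp_even := odd_case_exponents n_gt0 n_parity sigma_n.
  pose l := rem 3 (primes n).
  have l_uniq : uniq l by rewrite rem_uniq ?primes_uniq.
  have mem_l p : p \in l -> p != 3 /\ p \in primes n.
    by rewrite mem_rem_uniq ?primes_uniq // !inE => /andP[].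
  have nth_l (i : 'I_(size l)) : nth 0 l i \in l by rewrite mem_nth.
  exists (size l), (fun i => nth 0 l i), (logn 3 n)./2,
    (fun i => (logn (nth 0 l i) n)./2); split.
  + exact: odd_case_size.
  + exact: nth_inj.
  + move=> i; have [neq3] := mem_l _ (nth_l i).
    rewrite mem_primes => /and3P[p_pr _ p_n]; split=> //.
    have := dvdn_odd p_n n_parity; move: neq3 (prime_gt1 p_pr).
    by case: (nth 0 l i) => [|[|[|[|]]]].
  + split; first by apply: half_gt0 n3 (exp_even _ n3).
    move=> i; have [_ p_n] := mem_l _ (nth_l i).
    exact: half_gt0 p_n (exp_even _ p_n).
  rewrite {1}(prod_primes n_gt0) (big_rem 3 n3) /=.
  rewrite (half_double _ (exp_even _ n3)).
  congr (_ * _); rewrite prod_nth; apply: eq_bigr => i _.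
  have [_ p_n] := mem_l _ (nth_l i).
  by rewrite (half_double _ (exp_even _ p_n)).
have log2 : logn 2 n = 1.
  have : 0 < logn 2 n by rewrite logn_gt0 mem_primes n_gt0 dvdn2.
  have : ~~ (2 ^ 2 %| n).
    apply/negP => n4; have n3 : 3 %| n.
      have : 3 %| 7 * n by rewrite -sigma_n dvdn_mulr.
      by rewrite Gauss_dvdr.
    have n12 : 12 %| n by rewrite (_ : 12 = 2 ^ 2 * 3) // Gauss_dvd // n4.
    have lt_sigma := sigma_dvdn_ltn n_gt0 n12 (nesym n_neq12).
    suff sigma_12 : sigma 12 = 28 by move: lt_sigma; rewrite sigma_12; lia.
    rewrite (_ : 12 = 2 ^ 2 * 3 ^ 1) // sigma_coprime // !sigma_pfactor //.
    by rewrite !big_ord_recr !big_ord0.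
  by rewrite pfactor_dvdn //; lia.
have [m [m_gt0 co_2m def_n def_sigma]] := @sigma_split_pfactor 2 n isT n_gt0.
have m_odd : odd m by rewrite -coprime2n.
rewrite log2 expn1 in def_n def_sigma.
have sigma_2 : sigma 2 = 3 by rewrite /sigma !big_cons big_nil.
have sigma_m : 9 * sigma m = 14 * m.
  by move: sigma_n; rewrite def_sigma sigma_2 def_n; clear; lia.
have m_neq : m <> 117 by move=> m117; rewrite m117 in def_n.
have [q [m_q e_odd q_mod4 e_mod4 exp_even]] :=
  even_case_odd_exponent m_gt0 m_odd sigma_m.
have neq_q3 : q <> 3 by move=> q3; rewrite q3 in q_mod4.
have m3 : 3 \in primes m.
  by rewrite mem_primes m_gt0 /=; apply: dvdn_trans (even_case_9dvdn sigma_m).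
have v_even : ~~ odd (logn 3 m) by apply: exp_even (nesym neq_q3).
have v_ge6 := even_case_logn3 m_gt0 sigma_m m_neq v_even.
have ge29 := even_case_prime_ge29 m_gt0 sigma_m v_ge6.
have m_q3 : q \in rem 3 (primes m).
  by rewrite mem_rem_uniq ?primes_uniq // !inE m_q andbT; apply/eqP.
pose l := rem q (rem 3 (primes m)).
have l_uniq : uniq l by rewrite !rem_uniq ?primes_uniq.
have mem_l p : p \in l -> [/\ p <> q, p <> 3 & p \in primes m].
  rewrite mem_rem_uniq ?rem_uniq ?primes_uniq // !inE.
  rewrite mem_rem_uniq ?primes_uniq //.
  by rewrite !inE => /and3P[/eqP ? /eqP ? ?].
have nth_l (i : 'I_(size l)) : nth 0 l i \in l by rewrite mem_nth.
have primes_prime p : p \in primes m -> prime p.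
  by rewrite mem_primes => /andP[].
exists (size l), q, (fun i => nth 0 l i), (logn 3 m)./2, (logn q m),
  (fun i => (logn (nth 0 l i) m)./2); split.
- exact: even_case_size.
- split; first exact: nth_inj.
  by move=> i; have [] := mem_l _ (nth_l i).
- split; first by split; [exact: primes_prime | exact: ge29].
  move=> i; have [_ neq3 p_m] := mem_l _ (nth_l i).
  by split; [exact: primes_prime | exact: ge29].
- split=> //; first exact: half_leq v_ge6.
    by rewrite logn_gt0.
  move=> i; have [neq_q _ p_m] := mem_l _ (nth_l i).
  exact: half_gt0 p_m (exp_even _ p_m neq_q).
rewrite def_n {1}(prod_primes m_gt0) (big_rem 3 m3) (big_rem q m_q3) /=.
rewrite (half_double _ v_even) !mulnA; congr (_ * _).
rewrite prod_nth; apply: eq_bigr => i _.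
have [neq_q _ p_m] := mem_l _ (nth_l i).
by rewrite (half_double _ (exp_even _ p_m neq_q)).
Qed.
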